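(* Assume that for every $a\in A$ the set $\mathcal P_a$ is closed. Then the sender's persuasion problem can be optimized by solving the following convex optimization problem: $$\max_{\{t_a : a\in A\}}\ \sum_{\omega\in\Omega}\sum_{a\in A} t_a(\omega)v(\omega,a)\quad\text{subject to}\quad \sum_{a\in A}t_a(\omega)=\mu^*(\omega)\ \text{ for each } \omega\in\Omega,\qquad t_a\in \mathrm{Conv}(\mathcal P_a\cup\{\mathbf 0\})\ \text{ for each } a\in A.$$
   Context: $\Omega$ (states) and $A$ (actions) are finite sets. $\Delta(\Omega)\subset\mathbb R^{|\Omega|}$ is the set of probability vectors on $\Omega$ with the Euclidean topology, and $\mu^*\in\Delta(\Omega)$ is the prior common to sender and receiver. The receiver's utility is a function $\rho:\Delta(\Omega)\times A\to\mathbb R$ of belief and action (not necessarily linear in the belief); the sender's utility is $v:\Omega\times A\to\mathbb R$. For $a\in A$, $$\mathcal P_a=\{\mu\in\Delta(\Omega): a\in\arg\max_{a'\in A}\rho(\mu,a')\}.$$ $\mathrm{Conv}(H)$ is the set of all finite convex combinations of elements of $H$, and $\mathbf 0\in\mathbb R^{|\Omega|}$ is the zero vector. A signaling scheme $(S,\pi)$ consists of a signal space $S$ and a joint distribution $\pi\in\Delta(\Omega\times S)$ of the state $\bar\omega$ and the signal $\bar s$ whose marginal on $\Omega$ is $\mu^*$. For $s\in S$, $\mu_s\in\Delta(\Omega)$ denotes the receiver's posterior belief (by Bayes' rule) about $\bar\omega$ upon observing $\bar s=s$. A receiver strategy $a:S\to A$ is optimal if $a(s)\in\arg\max_{a\in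 A}\rho(\mu_s,a)$ for each $s\in S$. The sender's persuasion problem is to choose a signaling scheme maximizing $\mathbf E_\pi[v(\bar\omega,a(\bar s))]$, where the receiver responds with an optimal strategy $a(\cdot)$ and, if there are several optimal strategies, the one most preferred by the sender is used. *)

(* Defs.v *)
From HB Require Import structures.
From mathcomp Require Import all_boot all_order all_algebra.
From mathcomp Require Import all_classical all_reals all_analysis.

Set Implicit Arguments.
Unset Strict Implicit.
Unset Printing Implicit Defensive.

Import Order.TTheory GRing.Theory Num.Theory.
Import numFieldNormedType.Exports.

Local Open Scope classical_set_scope.
Local Open Scope ring_scope.

(* A finite type with the discrete sigma-algebra. The base point [x0] is only
   there because a measurableType must be pointed. *)
Definition discrete_meas (T : finType) (x0 : T) : Type := T.

HB.instance Definition _ (T : finType) (x0 : T) :=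
  Finite.copy (discrete_meas x0) T.
HB.instance Definition _ (T : finType) (x0 : T) :=
  isPointed.Build (discrete_meas x0) x0.
HB.instance Definition _ (T : finType) (x0 : T) :=
  @isMeasurable.Build default_measure_display (discrete_meas x0)
    discrete_measurable discrete_measurable0
    discrete_measurableC discrete_measurableU.

Definition maximizes (R : realType) (T : Type) (f : T -> R) (D : set T)
    (x : T) : Prop :=
  D x /\ forall y, D y -> f y <= f x.

Definition Conv (R : realType) (E : lmodType R) (H : set E) : set E :=
  [set x | exists (n : nat) (c : 'I_n -> R) (y : 'I_n -> E),
    [/\ forall i, 0 <= c i, \sum_(i < n) c i = 1, forall i, H (y i)
      & x = \sum_(i < n) c i *: y i]].

Section Persuasion.
Context {R : realType} {Omega A : finType}.

(* R^|Omega| is the function space [Omega -> R^o]; [R^o] is [R] seen as a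
   module over itself. Its Euclidean topology is the product topology
   [{ptws Omega -> R}], [Omega] being finite. *)
Definition Delta : set (Omega -> R^o) :=
  [set mu | (forall w, 0 <= mu w) /\ \sum_w mu w = 1].

(* The receiver's utility [rho mu a] is a total function of [mu], but only its
   values at [mu] in [Delta] are ever used. *)
Definition best_region (rho : (Omega -> R^o) -> A -> R) (a : A) :
    set (Omega -> R^o) :=
  [set mu | Delta mu /\ forall a', rho mu a' <= rho mu a].

Definition program_objective (v : Omega -> A -> R) (t : A -> Omega -> R^o) : R :=
  \sum_w \sum_a t a w * v w a.

Definition program_feasible (mu0 : Omega -> R^o)
    (rho : (Omega -> R^o) -> A -> R) : set (A -> Omega -> R^o) :=
  [set t | (forall w, \sum_a t a w = mu0 w) /\
           forall a, Conv (best_region rho a `|` [set 0]) (t a)].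

Section Scheme.
Context {d : measure_display} {S : measurableType d} {w0 : Omega}.
Variable pi : probability (discrete_meas w0 * S)%type R.

Definition signaling_scheme (mu0 : Omega -> R^o) : Prop :=
  forall w : Omega, pi ([set w] `*` [set: S]) = (mu0 w)%:E.

(* Bayes' rule for a general signal space: [mu] is a regular conditional
   distribution of the state given the signal, taking values in [Delta] for
   every (not just almost every) signal. On an atom [s] it reads
   [mu s w = pi (w, s) / pi (Omega, s)]; on null sets any version is allowed. *)
Definition posterior (mu : S -> Omega -> R^o) : Prop :=
  [/\ forall s, Delta (mu s),
      forall w, measurable_fun [set: S] (fun s => mu s w : R)
    & forall (w : Omega) (B : set S), measurable B ->
        pi ([set w] `*` B) = (\int[pushforward pi snd]_(s in B) (mu s w)%:E)%E].

Definition optimal_strategy (rho : (Omega -> R^o) -> A -> R)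
    (mu : S -> Omega -> R^o) (alpha : S -> A) : Prop :=
  (forall a, measurable (alpha @^-1` [set a])) /\
  forall s, best_region rho (alpha s) (mu s).

Definition sender_payoff (v : Omega -> A -> R) (alpha : S -> A) : \bar R :=
  ('E_pi [fun x => v x.1 (alpha x.2)])%E.

Definition sender_preferred (rho : (Omega -> R^o) -> A -> R)
    (v : Omega -> A -> R) (mu : S -> Omega -> R^o) (alpha : S -> A) : Prop :=
  optimal_strategy rho mu alpha /\
  forall alpha', optimal_strategy rho mu alpha' ->
    (sender_payoff v alpha' <= sender_payoff v alpha)%E.

Definition persuasion_outcome (mu0 : Omega -> R^o)
    (rho : (Omega -> R^o) -> A -> R) (v : Omega -> A -> R)
    (mu : S -> Omega -> R^o) (alpha : S -> A) : Prop :=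
  [/\ signaling_scheme mu0, posterior mu & sender_preferred rho v mu alpha].

End Scheme.

Definition optimal_persuasion (mu0 : Omega -> R^o)
    (rho : (Omega -> R^o) -> A -> R) (v : Omega -> A -> R)
    (d : measure_display) (S : measurableType d) (w0 : Omega)
    (pi : probability (discrete_meas w0 * S)%type R)
    (mu : S -> Omega -> R^o) (alpha : S -> A) : Prop :=
  persuasion_outcome pi mu0 rho v mu alpha /\
  forall (d' : measure_display) (S' : measurableType d')
    (pi' : probability (discrete_meas w0 * S')%type R)
    (mu' : S' -> Omega -> R^o) (alpha' : S' -> A),
    persuasion_outcome pi' mu0 rho v mu' alpha' ->
    (sender_payoff pi' v alpha' <= sender_payoff pi v alpha)%E.

End Persuasion.

(* Main.v *)
(** The value of an outcome depends only on the sub-probability vectors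
    [t_a(w) = pi(state = w, action = a)]. If [alpha] is optimal, [t_a] is the
    integral over [alpha^-1(a)] of posteriors lying in [P_a], hence belongs to
    [Conv(P_a u {0})]: that set is compact by Caratheodory's theorem, so a point
    outside it would be strictly separated from it, and the separating affine
    inequality can be integrated. Conversely, the points appearing in a
    decomposition of each [t_a] serve as posteriors of a finite scheme whose
    signals recommend the actions. The same compactness gives a maximizer. *)
Require Import Defs.
From HB Require Import structures.
From mathcomp Require Import all_boot all_order all_algebra.
From mathcomp Require Import measurable_realfun ring lra.
From mathcomp Require Import all_classical all_reals all_analysis.
Import Order.TTheory GRing.Theory Num.Theory.
Import numFieldNormedType.Exports.
Local Open Scope classical_set_scope.
Local Open Scope ring_scope.

Set Implicit Arguments.
Unset Strict Implicit.
Unset Printing Implicit Defensive.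

(** * Convex hulls *)

Lemma sub_Conv (R : realType) (E : lmodType R) (H : set E) : H `<=` Conv H.
Proof.
move=> x Hx; exists 1%N, (fun=> 1), (fun=> x); split => //.
- by rewrite big_ord1.
- by rewrite big_ord1 scale1r.
Qed.

(** Two combinations are concatenated over ['I_(n1 + n2)], the weights of the first scaled by [l]
    and those of the second by [1 - l]. *)
Lemma convex_Conv (R : realType) (E : lmodType R) (H : set E) :
  convex_set (Conv H).
Proof.
move=> _ _ l /set_mem[n1 [c1 [y1 [c1_ge0 c1_sum Hy1 ->]]]]
  /set_mem[n2 [c2 [y2 [c2_ge0 c2_sum Hy2 ->]]]]; apply/mem_set.
pose glue (T : Type) (f1 : 'I_n1 -> T) (f2 : 'I_n2 -> T) i :=
  match fintype.split i with inl j => f1 j | inr j => f2 j end.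
have glueL T f1 f2 i : @glue T f1 f2 (lshift n2 i) = f1 i.
  by rewrite /glue (unsplitK (inl i)).
have glueR T f1 f2 i : @glue T f1 f2 (rshift n1 i) = f2 i.
  by rewrite /glue (unsplitK (inr i)).
exists (n1 + n2)%N, (glue R (fun i => l%:num * c1 i)
  (fun i => (1 - l%:num) * c2 i)), (glue E y1 y2); split.
- by move=> i; rewrite /glue; case: fintype.split => j; rewrite mulr_ge0 ?onem_ge0.
- rewrite big_split_ord/=; under eq_bigr do rewrite glueL.
  under [X in _ + X]eq_bigr do rewrite glueR.
  by rewrite -!mulr_sumr c1_sum c2_sum !mulr1 addrC subrK.
- by move=> i; rewrite /glue; case: fintype.split.
- rewrite big_split_ord/=; under [in RHS]eq_bigr do rewrite !glueL -scalerA.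
  under [X in _ = _ + X]eq_bigr do rewrite !glueR -scalerA.
  by rewrite -!scaler_sumr.
Qed.

(** [Conv] with the number of points fixed, so that the weights and points range over one
    finite-dimensional parameter space. *)
Definition convex_combinations (R : realType) (E : lmodType R) (n : nat)
    (H : set E) : set E :=
  [set x | exists (c : 'I_n -> R) (y : 'I_n -> E),
    [/\ forall i, 0 <= c i, \sum_(i < n) c i = 1, forall i, H (y i)
      & x = \sum_(i < n) c i *: y i]].

(** Pads with a point of weight zero. That point must lie in [H], so [y ord0] is repeated; it exists
    because weights summing to one cannot form an empty family. *)
Lemma sub_convex_combinationsS (R : realType) (E : lmodType R) (n : nat)
    (H : set E) : convex_combinations n H `<=` convex_combinations n.+1 H.
Proof.
move=> _ [c [y [c_ge0 c_sum Hy ->]]].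
case: n => [|n] in c y c_ge0 c_sum Hy *.
  by move: c_sum => /eqP; rewrite big_ord0 eq_sym oner_eq0.
pose c' (i : 'I_n.+2) := oapp c 0 (unlift ord0 i).
pose y' (i : 'I_n.+2) := oapp y (y ord0) (unlift ord0 i).
have c'0 : c' ord0 = 0 by rewrite /c' unlift_none.
have c'S i : c' (lift ord0 i) = c i by rewrite /c' liftK.
have y'S i : y' (lift ord0 i) = y i by rewrite /y' liftK.
exists c', y'; split.
- by move=> i; rewrite /c'; case: unliftP => /=.
- by rewrite big_ord_recl c'0 add0r -c_sum; apply: eq_bigr => i _; rewrite c'S.
- by move=> i; rewrite /y'; case: unliftP => /=.
- rewrite [RHS]big_ord_recl c'0 scale0r add0r.
  by apply: eq_bigr => i _; rewrite c'S y'S.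
Qed.

(** The [n] vectors [(y i, 1)] live in dimension [#|I| + 1 < n], so the matrix with these rows has a
    nonzero left kernel. *)
Lemma affine_dependence (R : fieldType) (I : finType) (n : nat)
    (y : 'I_n -> I -> R) : (#|I|.+1 < n)%N ->
  exists u : 'I_n -> R, [/\ exists i, u i != 0, \sum_i u i = 0
    & forall w, \sum_i u i * y i w = 0].
Proof.
move=> ltIn.
(* The coordinate [None] carries the equation [\sum_i u i = 0]. *)
pose M := \matrix_(i < n, k < #|{: option I}|) oapp (y i) 1 (enum_val k).
have : kermx M != 0.
  rewrite kermx_eq0 /row_free neq_ltn (leq_ltn_trans (rank_leq_col M))//.
  by rewrite card_option.
case/rowV0Pn => u /sub_kermxP uM0 u_neq0; exists (u 0).
have uM o : \sum_i u 0 i * oapp (y i) 1 o = 0.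
  have := congr1 (fun A : 'rV_#|{: option I}| => A 0 (enum_rank o)) uM0.
  rewrite !mxE => uo; rewrite -[RHS]uo.
  by apply: eq_bigr => i _; rewrite mxE enum_rankK.
split; last by move=> w; exact: (uM (Some w)).
- by case/rV0Pn: u_neq0 => i; exists i.
- by rewrite -[RHS](uM None); apply: eq_bigr => i _; rewrite mulr1.
Qed.

(* Moving the weights along an affine dependence until one of them vanishes. *)
Lemma convex_combinations_pred (R : realType) (I : finType) (n : nat)
    (H : set (I -> R^o)) : (#|I|.+1 <= n)%N ->
  convex_combinations n.+1 H `<=` convex_combinations n H.
Proof.
move=> leIn _ [c [y [c_ge0 c_sum Hy ->]]].
have [//|u [[i0 u_neq0] u_sum uy]] := @affine_dependence R I n.+1 y _.
(* Coefficients with sum zero that are not all zero cannot all be nonpositive. *)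
have [j0 uj0_gt0] : exists j, 0 < u j.
  have [//|/forallNP u_le0] := pselect (exists j, 0 < u j).
  have Nu_ge0 j : 0 <= - u j by rewrite oppr_ge0 leNgt; exact/negP/u_le0.
  have : \sum_j - u j == 0 by rewrite sumrN u_sum oppr0.
  rewrite psumr_eq0; last by move=> j _; exact: Nu_ge0.
  by move/allP => /(_ i0); rewrite mem_index_enum oppr_eq0 (negbTE u_neq0) => /(_ isT).
(* The least ratio is the largest multiple of [u] that can be subtracted from [c] with all weights
   staying nonnegative; the weight at [j] then vanishes. *)
have [j uj_gt0 j_min] := @arg_minP _ R _ j0 (fun j => 0 < u j) (fun j => c j / u j) uj0_gt0.
pose c' i := c i - c j / u j * u i.
have c'j : c' j = 0 by rewrite /c' divfK ?subrr// gt_eqF.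
have c'_ge0 i : 0 <= c' i.
  rewrite subr_ge0; have [ui_gt0|ui_le0] := ltP 0 (u i).
    by rewrite -ler_pdivlMr//; exact: j_min.
  by rewrite (le_trans _ (c_ge0 i))// mulr_ge0_le0// divr_ge0// ltW.
have c'_sum : \sum_i c' i = 1.
  by rewrite sumrB -mulr_sumr u_sum mulr0 subr0.
have drop_j (V : nmodType) (F : 'I_n.+1 -> V) : F j = 0 ->
    \sum_i F i = \sum_i F (lift j i).
  by move=> Fj; rewrite (bigD1_ord j)//= Fj add0r.
exists (c' \o lift j), (y \o lift j); split => //=.
- by rewrite -[RHS]c'_sum (drop_j _ c').
- apply/funext => w.
  rewrite -(drop_j _ (fun i => c' i *: y i)) ?c'j ?scale0r// !fct_sumE.
  transitivity (\sum_i (c i * y i w - c j / u j * (u i * y i w))).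
    by rewrite sumrB -mulr_sumr uy mulr0 subr0.
  by apply: eq_bigr => i _; rewrite mulrA -mulrBl.
Qed.

(** Shorter combinations are padded and longer ones reduced, one point at a time. *)
Lemma Conv_caratheodory (R : realType) (I : finType) (H : set (I -> R^o)) :
  Conv H = convex_combinations #|I|.+1 H.
Proof.
apply/seteqP; split => [x [n Hx]|x Hx]; last by exists #|I|.+1.
have {}Hx : convex_combinations n H x by [].
have [le_nI|/ltnW le_In] := leqP n #|I|.+1.
  rewrite -(subnK le_nI); elim: (_ - n)%N => [//|m IHm].
  by rewrite addSn; exact: sub_convex_combinationsS.
move: Hx; rewrite -(subnK le_In); elim: (n - _)%N => [//|m IHm].
by rewrite addSn => /convex_combinations_pred Hx; apply/IHm/Hx; rewrite leq_addl.
Qed.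
(** * Compactness *)

Lemma compact_ptws (V : topologicalType) (I : eqType) (K : I -> set V) :
  (forall i, compact (K i)) ->
  compact [set f : {ptws I -> V} | forall i, K i (f i)].
Proof. exact: (@tychonoff I (fun=> V)). Qed.

Lemma continuous_eval (V : topologicalType) (I : eqType) (i : I) :
  continuous (fun f : {ptws I -> V} => f i).
Proof. exact: (@proj_continuous I (fun=> V)). Qed.

Lemma continuous_eval2 (V : topologicalType) (I J : eqType) (i : I) (j : J) :
  continuous (fun f : {ptws I -> {ptws J -> V}} => f i j).
Proof.
move=> f; apply: (@continuous_comp _ _ _
  (fun g : {ptws I -> {ptws J -> V}} => g i) (fun v : {ptws J -> V} => v j)).
  exact: continuous_eval.
exact: continuous_eval.
Qed.

(** The pointwise topology is the supremum of the topologies pulled back along the evaluations, so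
    convergence is checked one coordinate at a time. Constant functions show that evaluations are
    surjective, as [cvg_image] requires. *)
Lemma continuous_ptws (T V : topologicalType) (I : Type)
    (f : T -> {ptws I -> V}) :
  (forall i, continuous (fun x => f x i)) -> continuous f.
Proof.
move=> f_cont x; apply/cvg_sup => i.
have proj_surj : (fun g : I -> V => g i) @` setT = setT.
  by apply/seteqP; split => // v _; exists (fun=> v).
apply/cvg_image => // A /f_cont xA.
exists ((fun g : I -> V => g i) @^-1` A); first exact: xA.
by rewrite image_preimage.
Qed.

Lemma continuous_sum (R : realType) (T : topologicalType) (I : finType)
    (F : I -> T -> R) :
  (forall i, continuous (F i)) -> continuous (fun x => \sum_i F i x).
Proof.
move=> F_cont.
have add_cont : continuous (fun x : R * R => x.1 + x.2) by exact: add_continuous.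
by apply: (continuous_big add_cont).
Qed.

(** A closed subset of the unit cube: each coordinate is bounded by the total, which is one. *)
Lemma compact_simplex (R : realType) (I : finType) :
  compact (Delta : set {ptws I -> R}).
Proof.
have cube_compact :
    compact [set f : {ptws I -> R} | forall i, `[0, 1]%classic (f i)].
  exact (@compact_ptws R I (fun=> `[0, 1]%classic) (fun=> @segment_compact R 0 1)).
apply: (subclosed_compact _ cube_compact); last first.
  move=> f [f_ge0 f_sum] i /=; rewrite in_itv/= f_ge0/= -f_sum.
  rewrite (bigD1 i)//= lerDl; exact: sumr_ge0.
have -> : (Delta : set {ptws I -> R}) =
    (\bigcap_(i in setT) (fun f : {ptws I -> R} => f i) @^-1` [set r | 0 <= r])
    `&` (fun f : {ptws I -> R} => \sum_i f i) @^-1` [set 1].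
  apply/seteqP; split => f [f_ge0 f_sum]; split => // i; first by move=> _; exact: f_ge0.
  exact: (f_ge0 i Logic.I).
apply: closedI; first apply: closed_bigI => i _.
  apply: preimage_closed; last exact: closed_ge.
  by move=> f _; exact: continuous_eval.
apply: preimage_closed; last exact: closed_eq.
by move=> f _; apply: continuous_sum => i; exact: continuous_eval.
Qed.

(** Since Caratheodory's theorem bounds the length of combinations, the hull is the continuous image
    of a simplex times a finite power of [H]. *)
Lemma compact_Conv (R : realType) (I : finType) (H : set {ptws I -> R}) :
  compact H -> compact (Conv (H : set (I -> R^o)) : set {ptws I -> R}).
Proof.
move=> H_compact; rewrite Conv_caratheodory; set n := #|I|.+1.
pose comb (z : {ptws 'I_n -> R} * {ptws 'I_n -> {ptws I -> R}}) : {ptws I -> R} :=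
  fun w => \sum_i z.1 i * z.2 i w.
pose Hn := [set y : {ptws 'I_n -> {ptws I -> R}} | forall i, H (y i)].
have -> : (convex_combinations n (H : set (I -> R^o)) : set {ptws I -> R}) =
    comb @` ((Delta : set {ptws 'I_n -> R}) `*` Hn).
  apply/seteqP; split.
    move=> _ [c [y [c_ge0 c_sum Hy ->]]]; exists (c, y); first by split.
    by apply/funext => w; rewrite fct_sumE.
  move=> _ [[c y] [[c_ge0 c_sum] Hy] <-]; exists c, y; split => //.
  by apply/funext => w; rewrite fct_sumE.
apply: continuous_compact; last first.
  apply: compact_setX; first exact: compact_simplex.
  exact: (@compact_ptws {ptws I -> R} _ (fun=> H)).
apply: continuous_subspaceT; apply: continuous_ptws => w.
have weight_cont i : continuous
    (fun z : {ptws 'I_n -> R} * {ptws 'I_n -> {ptws I -> R}} => z.1 i).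
  move=> z; apply: (@continuous_comp _ _ _ fst (fun c : {ptws 'I_n -> R} => c i)).
    exact: cvg_fst.
  exact: continuous_eval.
have point_cont i : continuous
    (fun z : {ptws 'I_n -> R} * {ptws 'I_n -> {ptws I -> R}} => z.2 i w).
  move=> z; apply: (@continuous_comp _ _ _ snd
    (fun y : {ptws 'I_n -> {ptws I -> R}} => y i w)); first exact: cvg_snd.
  exact: continuous_eval2.
apply: continuous_sum => i z.
exact (cvgM (weight_cont i z) (point_cont i z)).
Qed.

Lemma compact_best_region (R : realType) (Omega A : finType)
    (rho : (Omega -> R^o) -> A -> R) (a : A) :
  closed (best_region rho a : set {ptws Omega -> R}) ->
  compact (best_region rho a : set {ptws Omega -> R}).
Proof.
move=> P_closed; apply: (subclosed_compact P_closed (@compact_simplex R Omega)).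
by move=> mu [].
Qed.

Lemma compact_Conv_best_region (R : realType) (Omega A : finType)
    (rho : (Omega -> R^o) -> A -> R) (a : A) :
  closed (best_region rho a : set {ptws Omega -> R}) ->
  compact (Conv (best_region rho a `|` [set 0]) : set {ptws Omega -> R}).
Proof.
move=> P_closed; apply: compact_Conv; apply: compactU; last exact: compact_set1.
exact: compact_best_region.
Qed.

(** A product of compact hulls, cut by the closed linear constraints on the marginal. *)
Lemma compact_program_feasible (R : realType) (Omega A : finType)
    (mu0 : Omega -> R^o) (rho : (Omega -> R^o) -> A -> R) :
  (forall a, closed (best_region rho a : set {ptws Omega -> R})) ->
  compact (program_feasible mu0 rho : set {ptws A -> {ptws Omega -> R}}).
Proof.
move=> P_closed.
have -> : (program_feasible mu0 rho : set {ptws A -> {ptws Omega -> R}}) =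
    [set t : {ptws A -> {ptws Omega -> R}} |
      forall a, Conv (best_region rho a `|` [set 0]) (t a)] `&`
    \bigcap_(w in setT)
      (fun t : {ptws A -> {ptws Omega -> R}} => \sum_a t a w) @^-1` [set mu0 w].
  apply/seteqP; split => t [t1 t2]; split => // w; first by move=> _; exact: t1.
  exact: (t2 w Logic.I).
apply: compact_closedI.
  apply: (@compact_ptws {ptws Omega -> R} A (fun a =>
    Conv (best_region rho a `|` [set 0]) : set {ptws Omega -> R})) => a.
  exact: compact_Conv_best_region.
apply: closed_bigI => w _; apply: preimage_closed; last exact: closed_eq.
move=> t _; apply: continuous_sum => a; exact: continuous_eval2.
Qed.

Lemma continuous_program_objective (R : realType) (Omega A : finType)
    (v : Omega -> A -> R) :
  continuous (program_objective v : {ptws A -> {ptws Omega -> R}} -> R).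
Proof.
apply: continuous_sum => w; apply: continuous_sum => a t.
exact (cvgM (@continuous_eval2 _ _ _ a w t) (cvg_cst (v w a))).
Qed.

(** * Existence of a maximizer of the program *)

Lemma best_region_nonempty (R : realType) (Omega A : finType)
    (rho : (Omega -> R^o) -> A -> R) (mu : Omega -> R^o) :
  (0 < #|A|)%N -> Delta mu -> exists a, best_region rho a mu.
Proof.
move=> /card_gt0P[a0 _] mu_Delta; exists [arg max_(a > a0) rho mu a]%O.
by case: arg_maxP => // a _ a_max; split => // a'; exact: a_max.
Qed.

(** The point of the uninformative scheme: the whole prior is put on one action optimal at [mu0],
    and every other action gets the zero vector. *)
Lemma program_feasible_nonempty (R : realType) (Omega A : finType)
    (mu0 : Omega -> R^o) (rho : (Omega -> R^o) -> A -> R) :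
  (0 < #|A|)%N -> Delta mu0 -> program_feasible mu0 rho !=set0.
Proof.
move=> A_gt0 mu0_Delta; have [a0 mu0_a0] := best_region_nonempty rho A_gt0 mu0_Delta.
exists (fun a => if a == a0 then mu0 else 0); split => [w|a].
  rewrite (bigD1 a0)//= eqxx big1 ?addr0// => a /negbTE ->.
  by [].
by apply: sub_Conv; case: eqP => [->|_]; [left | right].
Qed.

Lemma program_maximizer_exists (R : realType) (Omega A : finType)
    (mu0 : Omega -> R^o) (rho : (Omega -> R^o) -> A -> R) (v : Omega -> A -> R) :
  (0 < #|A|)%N -> Delta mu0 ->
  (forall a, closed (best_region rho a : set {ptws Omega -> R})) ->
  exists t, maximizes (program_objective v) (program_feasible mu0 rho) t.
Proof.
move=> A_gt0 mu0_Delta P_closed.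
have [t /set_mem tF t_max] :=
  @compact_EVT_max {ptws A -> {ptws Omega -> R}} R (program_objective v) _
  (program_feasible_nonempty rho A_gt0 mu0_Delta)
  (@compact_program_feasible _ _ _ mu0 _ P_closed)
  (continuous_subspaceT (@continuous_program_objective _ _ _ v)).
by exists t; split => // s sF; apply: t_max; exact/mem_set.
Qed.

(** * Convexity and separation *)

Lemma convex_program_feasible (R : realType) (Omega A : finType)
    (mu0 : Omega -> R^o) (rho : (Omega -> R^o) -> A -> R) :
  convex_set (program_feasible mu0 rho).
Proof.
move=> t s l /set_mem[t_sum t_Conv] /set_mem[s_sum s_Conv]; apply/mem_set; split.
- move=> w.
  transitivity (\sum_a (l%:num * t a w + (1 - l%:num) * s a w)) => //.
  by rewrite big_split/= -!mulr_sumr t_sum s_sum; ring.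
- move=> a; apply/set_mem; apply: convex_Conv; exact/mem_set.
Qed.

Lemma program_objective_conv (R : realType) (Omega A : finType)
    (v : Omega -> A -> R) (l : {i01 R})
    (t s : convex_lmodType (A -> Omega -> R^o)) :
  program_objective v (conv l t s) =
  l%:num * program_objective v t + (1 - l%:num) * program_objective v s.
Proof.
rewrite /program_objective !mulr_sumr -big_split/=; apply: eq_bigr => w _.
rewrite !mulr_sumr -big_split/=; apply: eq_bigr => a _.
by rewrite !mulrA -mulrDl.
Qed.

(** The objective is linear, so the convexity inequality holds with equality; the sign turns
    maximization into convex minimization. *)
Lemma convex_program_objective (R : realType) (Omega A : finType)
    (v : Omega -> A -> R) (D : set (A -> Omega -> R^o)) :
  convex_function (D : set (convex_lmodType _))
    (fun t => - program_objective v t).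
Proof.
move=> l t s _ _; rewrite program_objective_conv opprD -!mulrN.
exact: lexx.
Qed.

(* The normal vector is [x - p] with [p] the point of [C] nearest to [x]. *)
Lemma strict_separation (R : realType) (I : finType) (C : set (I -> R^o))
    (x : I -> R^o) :
  convex_set C -> compact (C : set {ptws I -> R}) -> C !=set0 -> ~ C x ->
  exists (g : I -> R) (b : R),
    (forall z, C z -> \sum_i g i * z i <= b) /\ b < \sum_i g i * x i.
Proof.
move=> C_convex C_compact C_neq0 xNC.
pose dist2 (z : {ptws I -> R}) : R := \sum_i (x i - z i) * (x i - z i).
have dist2_cont : continuous dist2.
  apply: continuous_sum => i z.
  have sub_cont : x i - y i @[y --> z] --> x i - z i.
    exact (cvgB (cvg_cst (x i)) (@continuous_eval _ _ i z)).
  exact (cvgM sub_cont sub_cont).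
have [p /set_mem Cp p_min] := @compact_EVT_min {ptws I -> R} R dist2 _
  C_neq0 C_compact (continuous_subspaceT dist2_cont).
pose g i : R := x i - p i.
(* If the squared norm vanished, [x] would equal [p] and hence lie in [C]. *)
have g2_gt0 : 0 < \sum_i g i * g i.
  rewrite lt_neqAle sumr_ge0 ?andbT; last by move=> i _; exact: sqr_ge0.
  rewrite eq_sym psumr_eq0; last by move=> i _; exact: sqr_ge0.
  apply/negP => /allP g_eq0; apply: xNC; suff -> : x = p by [].
  apply/funext => i; apply/eqP; rewrite -subr_eq0.
  have := g_eq0 i (mem_index_enum i).
  by rewrite mulf_eq0 orbb.
exists g, (\sum_i g i * p i); split; last first.
  rewrite -subr_gt0 -sumrB; under eq_bigr do rewrite -mulrBr; exact: g2_gt0.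
move=> z Cz; rewrite -subr_le0 -sumrB; under eq_bigr do rewrite -mulrBr.
set gh := \sum_i _; pose hh : R := \sum_i (z i - p i) * (z i - p i).
have hh_ge0 : 0 <= hh by apply: sumr_ge0 => i _; exact: sqr_ge0.
(* Minimality of [p] against the point [p + l (z - p)] of the segment, after expanding the squared
   distance and dividing by [l]. *)
have step (l : R) (l_gt0 : 0 < l) (l_le1 : l <= 1) : 2 * gh <= l * hh.
  have l01 : Itv.spec (@Itv.num_sem R) (Itv.Real `[0%Z, 1%Z]) l.
    by apply/andP; split; [exact: num_real | rewrite in_itv/= (ltW l_gt0)].
  pose q : {ptws I -> R} := fun i => l * z i + (1 - l) * p i.
  have Cq : q \in C := C_convex z p (Itv.mk l01) (mem_set Cz) (mem_set Cp).
  have := p_min q Cq; have -> : dist2 q = dist2 p - 2 * l * gh + l * l * hh.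
    rewrite /gh /hh /dist2 !mulr_sumr -sumrB -big_split/=.
    by apply: eq_bigr => i _; rewrite /q /g; ring.
  by move=> q_ge0; rewrite -(ler_pM2l l_gt0); lra.
rewrite leNgt; apply/negP => gh_gt0.
(* At [l = 1] the bound reads [2 * gh <= hh], so [gh / hh] is an admissible value of [l]; there the
   bound becomes [2 * gh <= gh], which is absurd. *)
have := step 1 ltr01 (lexx 1); rewrite mul1r => gh_le_hh.
have hh_gt0 : 0 < hh by apply: lt_le_trans gh_le_hh; rewrite mulr_gt0.
have := step (gh / hh); rewrite divfK ?gt_eqF// divr_gt0// ler_pdivrMr// mul1r.
move=> /(_ isT); lra.
Qed.

(** * Feasibility of outcomes *)

(** If the integral were outside [C], a separating inequality valid at every [f t] could be
    integrated over [D] and would contradict the separation. The mass missing from [mu D] is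
    attributed to the point [0] of [C]. *)
Lemma compact_convex_barycenter (R : realType) (d : measure_display)
    (T : measurableType d) (mu : {measure set T -> \bar R}) (I : finType)
    (C : set (I -> R^o)) (D : set T) (f : T -> I -> R^o) :
  convex_set C -> compact (C : set {ptws I -> R}) -> C 0 ->
  measurable D -> (mu D <= 1)%E ->
  (forall i, mu.-integrable D (fun t => (f t i)%:E)) ->
  (forall t, D t -> C (f t)) ->
  C (fun i => \int[mu]_(t in D) f t i).
Proof.
move=> C_convex C_compact C0 mD muD_le1 f_int Cf; apply: contrapT => xNC.
have [g [b [gC]]] := strict_separation C_convex C_compact (ex_intro _ 0 C0) xNC.
(* The bound holds at [0], so [b] is nonnegative and integrating it over [D] gives
   [b * mu D <= b]. *)
have b_ge0 : 0 <= b.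
  by apply: le_trans (gC 0 C0); rewrite big1// => i _; exact: mulr0.
have gf_int i : mu.-integrable D (fun t => (g i * f t i)%:E).
  by under eq_fun do rewrite EFinM; exact: integrableZl.
have -> : \sum_i g i * (\int[mu]_(t in D) f t i) =
    \int[mu]_(t in D) (\sum_i g i * f t i).
  rewrite /Rintegral; under [in RHS]eq_integral do rewrite -sumEFin.
  rewrite integral_sum// -sum_fine; last by move=> i _; exact: integrable_fin_num.
  apply: eq_bigr => i _; rewrite -RintegralZl//.
  exact: f_int.
apply/negP; rewrite -leNgt.
have D_fin : mu D \is a fin_num.
  by rewrite ge0_fin_numE// (le_lt_trans muD_le1)// ltry.
apply: (@le_trans _ _ (\int[mu]_(t in D) b)); last first.
  by rewrite Rintegral_cst// ler_piMr// -lee_fin fineK.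
apply: le_Rintegral => //.
- rewrite (_ : EFin \o _ = fun t => (\sum_i (g i * f t i)%:E)%E).
    by apply: integrable_sum.
  by apply/funext => t; rewrite sumEFin.
- apply: measurable_bounded_integrable => //.
    by rewrite (le_lt_trans muD_le1)// ltry.
  exact: bounded_cst.
- by move=> t Dt; exact/gC/Cf.
Qed.

Section Outcome.
Context {R : realType} {Omega A : finType} {d : measure_display}
  {S : measurableType d} {w0 : Omega}.
Variable pi : probability (discrete_meas w0 * S)%type R.
Implicit Types (mu : S -> Omega -> R^o) (alpha : S -> A).

(** The candidate point of the program attached to an outcome: the joint law of the state and the
    action played. *)
Definition action_mass alpha (a : A) : Omega -> R^o :=
  fun w => fine (pi ([set w] `*` (alpha @^-1` [set a]))).

Lemma action_massE alpha a w : measurable (alpha @^-1` [set a]) ->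
  (action_mass alpha a w)%:E = pi ([set w] `*` (alpha @^-1` [set a])).
Proof.
by move=> ma; rewrite fineK// fin_num_measure//; exact: measurableX.
Qed.

Lemma sum_action_mass (mu0 : Omega -> R^o) alpha w : signaling_scheme pi mu0 ->
  (forall a, measurable (alpha @^-1` [set a])) ->
  \sum_a action_mass alpha a w = mu0 w.
Proof.
move=> pi_mu0 alpha_meas; apply: EFin_inj; rewrite -pi_mu0 -sumEFin.
(* The signals are partitioned according to the action that they induce. *)
rewrite (_ : [set w] `*` setT =
    \bigcup_(a in [set` index_enum A]) ([set w] `*` (alpha @^-1` [set a]))); last first.
  apply/seteqP; split => -[w' s] /=; last by case=> a _ [].
  by case=> -> _; exists (alpha s) => //=; exact: mem_index_enum.
rewrite measure_fin_bigcup//=.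
- rewrite -fsbig_seq ?index_enum_uniq//.
  by apply: eq_bigr => a _; exact: action_massE.
- apply/trivIsetP => a b _ _ ab; apply/seteqP; split => -[w' s] //=.
  by move=> [[_ /= sa] [_ /= sb]]; move: ab; rewrite -sa -sb eqxx.
- by move=> a _; exact: measurableX.
Qed.

(** On the event that [a] is played, every posterior lies in [best_region rho a]; the vector of
    masses is the integral of these posteriors over an event of probability at most one. *)
Lemma action_mass_Conv rho mu alpha a : posterior pi mu ->
  optimal_strategy rho mu alpha ->
  closed (best_region rho a : set {ptws Omega -> R}) ->
  Conv (best_region rho a `|` [set 0]) (action_mass alpha a).
Proof.
move=> [mu_Delta mu_meas pi_mu] [alpha_meas alpha_best] P_closed.
pose D := (snd : discrete_meas w0 * S -> S) @^-1` (alpha @^-1` [set a]).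
have mD : measurable D by rewrite -[D]setTI; exact: measurable_snd.
have mu_meas2 w : measurable_fun [set: discrete_meas w0 * S] (fun x => mu x.2 w : R).
  exact (measurableT_comp (mu_meas w) measurable_snd).
(* Bayes' rule on the signals inducing [a], with the integral pulled back from the signal marginal
   to [pi]. *)
have -> : action_mass alpha a = fun w => \int[pi]_(x in D) (mu x.2 w : R).
  apply/funext => w; rewrite /action_mass pi_mu//.
  rewrite ge0_integral_pushforward//.
  - exact/measurable_EFinP/measurable_funTS.
  - by move=> s _; rewrite lee_fin; case: (mu_Delta s).
apply: compact_convex_barycenter => //.
- exact: convex_Conv.
- exact: compact_Conv_best_region.
- by apply: sub_Conv; right.
- exact: probability_le1.
- move=> w; apply: measurable_bounded_integrable => //.
  + by rewrite (le_lt_trans (probability_le1 _ _))// ltry.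
  + exact: measurable_funTS.
  + exists 1; split; first exact: num_real.
    move=> M M_gt1 x _ /=; have [mu_ge0 mu_sum] := mu_Delta x.2.
    rewrite ger0_norm// (le_trans _ (ltW M_gt1))// -mu_sum.
    by rewrite (bigD1 w)//= lerDl; exact: sumr_ge0.
- move=> x <-; apply: sub_Conv; left; exact: alpha_best.
Qed.

Lemma action_mass_feasible (mu0 : Omega -> R^o) rho mu alpha : signaling_scheme pi mu0 ->
  posterior pi mu -> optimal_strategy rho mu alpha ->
  (forall a, closed (best_region rho a : set {ptws Omega -> R})) ->
  program_feasible mu0 rho (action_mass alpha).
Proof.
move=> pi_mu0 pi_mu alpha_opt P_closed; split => [w|a].
  by apply: sum_action_mass pi_mu0 _; case: alpha_opt.
exact: action_mass_Conv pi_mu alpha_opt (P_closed a).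
Qed.

(** The integrand is constant on each cell of state and action, hence a finite combination of
    indicators. *)
Lemma sender_payoffE v alpha : (forall a, measurable (alpha @^-1` [set a])) ->
  sender_payoff pi v alpha = (program_objective v (action_mass alpha))%:E.
Proof.
move=> alpha_meas.
pose cell (p : Omega * A) : set (discrete_meas w0 * S) :=
  [set p.1] `*` (alpha @^-1` [set p.2]).
have cell_meas p : measurable (cell p) by exact: measurableX.
rewrite /sender_payoff unlock /program_objective pair_big/= -sumEFin.
under eq_integral => x _.
  rewrite (_ : (v x.1 (alpha x.2))%:E =
    (\sum_p (v p.1 p.2 * \1_(cell p) x)%:E)%E); first over.
  rewrite (bigD1 (x.1 : Omega, alpha x.2))//= indicE mem_set// mulr1.
  rewrite big1 ?adde0// => -[w a] wa_neq; rewrite indicE memNset ?mulr0//=.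
  by move=> [/= xw xa]; move: wa_neq; rewrite xw xa eqxx.
have cell_int p : pi.-integrable setT (fun x => (v p.1 p.2 * \1_(cell p) x)%:E).
  under eq_fun do rewrite EFinM.
  by apply: integrableZl => //; exact: integrable_indic.
rewrite integral_sum//; apply: eq_bigr => -[w a] _ /=.
under eq_integral do rewrite EFinM.
rewrite integralZl//; last exact: integrable_indic.
by rewrite integral_indic// setIT [in RHS]mulrC EFinM action_massE.
Qed.

End Outcome.

(** * Finite schemes *)

(** Built as a weighted sum of Dirac masses, for which measure and integral are both finite sums. *)
Lemma finitely_supported_probability (R : realType) (d : measure_display)
    (T : measurableType d) (I : finType) (p : I -> R) (x : I -> T) :
  (forall i, 0 <= p i) -> \sum_i p i = 1 ->
  exists P : probability T R,
    (forall B, P B = (\sum_i (p i)%:E * \d_(x i) B)%E) /\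
    forall (D : set T) (f : T -> \bar R), measurable D -> measurable_fun D f ->
      (forall t, D t -> (0 <= f t)%E) ->
      (\int[P]_(t in D) f t = \sum_i (p i)%:E * (\d_(x i) D * f (x i)))%E.
Proof.
move=> p_ge0 p_sum.
pose atom (i : I) : {measure set T -> \bar R} :=
  mscale (NngNum (p_ge0 i)) (dirac (x i)).
(* [msum] runs over natural numbers, so [I] is enumerated; indices past [#|I|] get the zero
   measure. *)
pose m (k : nat) : {measure set T -> \bar R} :=
  oapp (fun i : 'I_#|I| => atom (enum_val i)) mzero (insub k).
have mE (i : 'I_#|I|) : m i = atom (enum_val i) by rewrite /m valK.
have PE B : msum m #|I| B = (\sum_i (p i)%:E * \d_(x i) B)%E.
  rewrite /msum; under eq_bigr do rewrite mE.
  by rewrite -(big_enum_val (fun i => atom i B)); apply: eq_bigl.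
have P_setT : msum m #|I| setT = 1%E.
  rewrite PE -[1%E]/(1%:E) -p_sum -sumEFin.
  by apply: eq_bigr => i _; rewrite diracT mule1.
pose P : probability T R := HB.pack (msum m #|I|)
  (Measure_isProbability.Build _ _ _ (msum m #|I|) P_setT).
exists P; split=> // D f mD mf f_ge0.
rewrite ge0_integral_measure_sum//.
under eq_bigr do rewrite mE.
rewrite -(big_enum_val (fun i => \int[atom i]_(t in D) f t)%E)/=.
by apply: eq_big => // i _; rewrite ge0_integral_mscale// integral_dirac.
Qed.

Lemma measurable_discrete (T : finType) (x0 : T) (d : measure_display)
    (U : measurableType d) (D : set (discrete_meas x0))
    (f : discrete_meas x0 -> U) : measurable_fun D f.
Proof. by []. Qed.

Lemma finite_signaling_scheme (R : realType) (Omega S : finType) (w0 : Omega)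
    (s0 : S) (q : S -> R) (mu : S -> Omega -> R^o) :
  (forall s, 0 <= q s) -> \sum_s q s = 1 -> (forall s, Delta (mu s)) ->
  exists pi : probability (discrete_meas w0 * discrete_meas s0)%type R,
    posterior pi mu /\
    forall (w : Omega) (B : set S), pi ([set w] `*` B) =
      (\sum_s q s * mu s w * (s \in B)%:R)%:E.
Proof.
move=> q_ge0 q_sum mu_Delta.
(* The signal is drawn from [q], then the state from [mu s]; Bayes' rule gives [mu s] back. *)
pose p (z : Omega * S) := q z.2 * mu z.2 z.1.
have p_ge0 z : 0 <= p z by apply: mulr_ge0 => //; case: (mu_Delta z.2).
have p_sum : \sum_z p z = 1.
  rewrite -(pair_bigA _ (fun w s => q s * mu s w))/= exchange_big/= -q_sum.
  by apply: eq_bigr => s _; rewrite -mulr_sumr; case: (mu_Delta s) => _ ->; rewrite mulr1.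
have [pi [piE pi_int]] := @finitely_supported_probability R _
  (discrete_meas w0 * discrete_meas s0)%type _ p id p_ge0 p_sum.
have pi_rect (w : Omega) (B : set S) : pi ([set w] `*` B) =
    (\sum_s q s * mu s w * (s \in B)%:R)%:E.
  rewrite piE; under eq_bigr do rewrite diracE -EFinM.
  rewrite sumEFin; congr EFin.
  rewrite -(pair_bigA _ (fun w' s => q s * mu s w' * ((w', s) \in [set w] `*` B)%:R))/=.
  rewrite (bigD1 w)//= [X in _ + X]big1 ?addr0; last first.
    move=> w' w'w; apply: big1 => s _; rewrite memNset ?mulr0//.
    by case=> /= /eqP; rewrite (negbTE w'w).
  apply: eq_bigr => s _; congr (_ * _%:R); congr nat_of_bool.
  by apply/idP/idP => /set_mem; [case=> _ /mem_set | move=> sB; apply/mem_set].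
exists pi; split => //; split => // w B mB.
rewrite pi_rect ge0_integral_pushforward//; last first.
  by move=> s _; rewrite lee_fin; case: (mu_Delta s).
rewrite pi_int//; first last.
- by move=> x _; rewrite lee_fin; case: (mu_Delta x.2).
- apply: measurable_funTS.
  pose f (s : discrete_meas s0) : \bar R := (mu s w)%:E.
  exact (measurableT_comp (@measurable_discrete _ _ _ _ setT f) measurable_snd).
- by rewrite -[X in measurable X]setTI; exact: measurable_snd.
under [in RHS]eq_bigr do rewrite diracE -!EFinM.
rewrite sumEFin; congr EFin.
(* Summing over the drawn state [w'] leaves the signal marginal [q s], as [mu s] has total mass
   one. *)
rewrite -(pair_bigA _ (fun w' s => q s * mu s w' * ((s \in B)%:R * mu s w)))/=.
rewrite exchange_big/=; apply: eq_bigr => s _.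
rewrite -mulr_suml -mulr_sumr; case: (mu_Delta s) => _ ->.
by rewrite mulr1 -mulrA; congr (_ * _); rewrite mulrC.
Qed.

(* A point [y a i] outside [best_region rho a] is the added point [0]; its
   signal gets mass [0], the posterior [mu0] and an action optimal at [mu0]. *)
Lemma feasible_implementable (R : realType) (Omega A : finType) (w0 : Omega)
    (mu0 : Omega -> R^o) (rho : (Omega -> R^o) -> A -> R) (t : A -> Omega -> R^o) :
  (0 < #|A|)%N -> Delta mu0 -> program_feasible mu0 rho t ->
  exists (d : measure_display) (S : measurableType d)
    (pi : probability (discrete_meas w0 * S)%type R)
    (mu : S -> Omega -> R^o) (alpha : S -> A),
    [/\ signaling_scheme pi mu0, posterior pi mu, optimal_strategy rho mu alpha
      & forall a w, pi ([set w] `*` (alpha @^-1` [set a])) = (t a w)%:E].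
Proof.
move=> A_gt0 mu0_Delta [t_sum t_Conv].
have [a0 a0_best] := best_region_nonempty rho A_gt0 mu0_Delta.
set n := #|Omega|.+1.
have /choice[cy cyP] : forall a, exists cy : ('I_n -> R) * ('I_n -> Omega -> R^o),
    [/\ forall i, 0 <= cy.1 i, forall i, (best_region rho a `|` [set 0]) (cy.2 i)
      & t a = \sum_(i < n) cy.1 i *: cy.2 i].
  move=> a; have := t_Conv a; rewrite Conv_caratheodory => -[c [y [c_ge0 _ Hy ->]]].
  by exists (c, y).
(* One signal for each action and each point in the decomposition of its vector. *)
pose S : finType := (A * 'I_n)%type; pose s0 : S := (a0, ord0).
pose y (s : S) := (cy s.1).2 s.2.
pose good (s : S) : bool := `[< best_region rho s.1 (y s) >].
pose q (s : S) := if good s then (cy s.1).1 s.2 else 0.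
pose mu (s : S) := if good s then y s else mu0.
pose alpha (s : S) := if good s then s.1 else a0.
have mu_best s : best_region rho (alpha s) (mu s).
  by rewrite /alpha /mu; case: ifPn => // /asboolP.
have mu_Delta s : Delta (mu s) by case: (mu_best s).
have q_ge0 s : 0 <= q s by rewrite /q; case: ifP => // _; case: (cyP s.1).
(* The replacement at bad signals changes no mass: there the left side has [q s = 0] and the right
   side [y s = 0]. *)
have q_mu s b w : q s * mu s w * (alpha s == b)%:R =
    (cy s.1).1 s.2 * y s w * (s.1 == b)%:R.
  rewrite /q /mu /alpha; case: ifPn => // /asboolPn Ns; rewrite !mul0r.
  have [_ /(_ s.2)[//|y0] _] := cyP s.1.
  by rewrite /y y0 mulr0 mul0r.
have q_mu_alpha b w : \sum_s q s * mu s w * (alpha s == b)%:R = t b w.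
  under eq_bigr do rewrite q_mu.
  rewrite -(pair_bigA _ (fun a i => (cy a).1 i * y (a, i) w * (a == b)%:R))/=.
  rewrite (bigD1 b)//= [X in _ + X]big1 ?addr0; last first.
    by move=> a /negbTE ->; apply: big1 => i _; rewrite mulr0.
  have [_ _ ->] := cyP b; rewrite fct_sumE.
  by apply: eq_bigr => i _; rewrite eqxx mulr1.
have q_mu_sum w : \sum_s q s * mu s w = mu0 w.
  rewrite -t_sum; under [in RHS]eq_bigr do rewrite -q_mu_alpha.
  rewrite exchange_big/=; apply: eq_bigr => s _.
  rewrite (bigD1 (alpha s))//= eqxx mulr1 big1 ?addr0// => b.
  by rewrite eq_sym => /negbTE ->; rewrite mulr0.
(* Each posterior sums to one over the states, so [q] has the same total mass as [mu0]. *)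
have q_sum : \sum_s q s = 1.
  have [_ <-] := mu0_Delta; under [in RHS]eq_bigr do rewrite -q_mu_sum.
  rewrite exchange_big/=; apply: eq_bigr => s _.
  by rewrite -mulr_sumr; have [_ ->] := mu_Delta s; rewrite mulr1.
have [pi [pi_mu piE]] := finite_signaling_scheme w0 s0 q_ge0 q_sum mu_Delta.
exists default_measure_display, (discrete_meas s0), pi, mu, alpha; split => //.
- move=> w; rewrite piE -q_mu_sum; congr EFin.
  by apply: eq_bigr => s _; rewrite in_setT mulr1.
- move=> a w; rewrite piE -q_mu_alpha; congr EFin.
  apply: eq_bigr => s _; congr (_ * _%:R); congr nat_of_bool.
  by apply/idP/eqP => [/set_mem//|sa]; apply/mem_set.
Qed.

(** * Equivalence of the program and the persuasion problem *)

Unset Implicit Arguments.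

Theorem theorem1 (R : realType) (Omega A : finType) (w0 : Omega)
    (hA : (0 < #|A|)%N)
    (mu0 : Omega -> R^o) (hmu0 : Delta mu0)
    (rho : (Omega -> R^o) -> A -> R) (v : Omega -> A -> R)
    (hP : forall a : A, closed (best_region rho a : set {ptws Omega -> R})) :
  [/\ convex_set (program_feasible mu0 rho),
      convex_function (program_feasible mu0 rho)
        (fun t => - program_objective v t),
      exists t, maximizes (program_objective v) (program_feasible mu0 rho) t
    & forall t, maximizes (program_objective v) (program_feasible mu0 rho) t ->
      exists (d : measure_display) (S : measurableType d)
        (pi : probability (discrete_meas w0 * S)%type R)
        (mu : S -> Omega -> R^o) (alpha : S -> A),
        [/\ optimal_persuasion mu0 rho v pi mu alpha,
            forall (a : A) (w : Omega),
              pi ([set w] `*` (alpha @^-1` [set a])) = (t a w)%:E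
          & sender_payoff pi v alpha = (program_objective v t)%:E]].
Proof.
(* The bound covers every optimal strategy, preferred by the sender or not. It thus serves twice:
   against other strategies under the same scheme, and against other schemes. *)
have outcome_le (t : A -> Omega -> R^o) :
    maximizes (program_objective v) (program_feasible mu0 rho) t ->
    forall (d : measure_display) (S : measurableType d)
      (pi : probability (discrete_meas w0 * S)%type R)
      (mu : S -> Omega -> R^o) (alpha : S -> A),
    signaling_scheme pi mu0 -> posterior pi mu -> optimal_strategy rho mu alpha ->
    (sender_payoff pi v alpha <= (program_objective v t)%:E)%E.
  move=> [_ t_max] d S pi mu alpha pi_mu0 pi_mu alpha_opt.
  rewrite sender_payoffE; last by case: alpha_opt.
  by rewrite lee_fin; apply: t_max; exact: action_mass_feasible pi_mu alpha_opt _.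
split.
- exact: convex_program_feasible.
- exact: convex_program_objective.
- exact: program_maximizer_exists.
- move=> t t_max.
  have [tF _] := t_max.
  have [d [S [pi [mu [alpha [pi_mu0 pi_mu alpha_opt pi_t]]]]]] :=
    feasible_implementable w0 hA hmu0 tF.
  have payoff_t : sender_payoff pi v alpha = (program_objective v t)%:E.
    rewrite sender_payoffE; last by case: alpha_opt.
    (* The constructed scheme has exactly [t] as its masses, so it attains the bound. *)
    congr (program_objective v _)%:E; apply/funext => a; apply/funext => w.
    by rewrite /action_mass pi_t.
  exists d, S, pi, mu, alpha; split => //; split.
    split => //; split => // alpha' alpha'_opt.
    by rewrite payoff_t; exact: outcome_le pi_mu0 pi_mu alpha'_opt.
  move=> d' S' pi' mu' alpha' [pi'_mu0 pi'_mu' [alpha'_opt _]].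
  by rewrite payoff_t; exact: outcome_le pi'_mu0 pi'_mu' alpha'_opt.
Qed.
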